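(* Let $\mathcal{M}$ be a topological surface with gluing data. Suppose that the space of differentiable functions on $\mathcal{M}$ is ample and that the following condition holds at every interior vertex $\gamma$ (with faces $\sigma_1,\dots,\sigma_F$ and gluing data $[\mathfrak a_i,\mathfrak b_i]$ as in the context): $$\prod_{i=1}^{F}\begin{pmatrix}0&1\\ \mathfrak b_i(0)&\mathfrak a_i(0)\end{pmatrix}=\begin{pmatrix}1&0\\0&1\end{pmatrix}$$ (product written from left to right for $i=1,\dots,F$). Then at every crossing vertex $\gamma$ with $4$ incident edges the gluing data satisfies $$\mathfrak a_1'(0)+\frac{\mathfrak b_4'(0)}{\mathfrak b_4(0)}=-\mathfrak b_1(0)\left(\mathfrak a_3'(0)+\frac{\mathfrak b_2'(0)}{\mathfrak b_2(0)}\right),\qquad \mathfrak a_2'(0)+\frac{\mathfrak b_1'(0)}{\mathfrak b_1(0)}=-\mathfrak b_2(0)\left(\mathfrak a_4'(0)+\frac{\mathfrak b_3'(0)}{\mathfrak b_3(0)}\right).$$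
   Context: **Topological surface.** $\mathcal{M}$ is given by a finite collection of polygons (faces) in $\mathbb{R}^2$ with certain pairs of polygon edges identified by homeomorphisms; each polygon edge is paired with at most one other edge and never with itself. Edges and vertices of $\mathcal{M}$ are the classes of identified polygon edges, resp. vertices. An edge is interior if it comes from an identified pair; a vertex is interior if the faces around it close up cyclically. **Gluing data.** Let $\gamma$ be an interior vertex with faces $\sigma_1,\dots,\sigma_F$ in cyclic order (indices mod $F$), $\sigma_i$ and $\sigma_{i+1}$ sharing the edge $\tau_i$. On each $\sigma_i$ use affine coordinates $(u_i,v_i)$ with $\gamma=(0,0)$, $\tau_i=\{(t,0):t\in[0,1]\}$ and $\tau_{i-1}=\{(0,t):t\in[0,1]\}$; the point $(t,0)$ of $\tau_i$ in $\sigma_i$ is identified with $(0,t)$ in $\sigma_{i+1}$. The transition map across $\tau_i$ is a $C^1$-diffeomorphism between open neighbourhoods of $\tau_i$, from $\sigma_i$-coordinates to $\sigma_{i+1}$-coordinates, of the form $(u_i,v_i)\mapsto(v_i\mathfrak b_i(u_i)+v_i^2\rho_1(u_i,v_i),\ u_i+v_i\mathfrak a_i(u_i)+v_i^2\rho_2(u_i,v_i))$ with $C^1$ functions $\mathfrak a_i,\mathfrak b_i,\rho_1,\rho_2$; $[\mathfrak a_i,\mathfrak b_i]$ is the gluing data at $\gamma$ along $\tau_i$. The edge $\tau_i$ is a crossing edge at $\gamma$ if $\mathfrak a_i(0)=0$; $\gamma$ is a crossing vertex if it is interior and all its edges are crossing edges at $\gamma$. **Differentiable functions.** A differentiable function on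 $\mathcal{M}$ is a family $f=(f_\sigma)_\sigma$ of differentiable functions $f_\sigma:U_\sigma\to\mathbb{R}$, one for each face $\sigma$, with $U_\sigma\subset\mathbb{R}^2$ an open set containing $\sigma$, such that at every point of each interior edge the Taylor expansions of order $1$ agree after composition with the transition map; across $\tau_i$ this means, for $t\in[0,1]$, $f_{\sigma_i}(t,0)=f_{\sigma_{i+1}}(0,t)$ and $\partial_{v_i}f_{\sigma_i}(t,0)=\mathfrak b_i(t)\,\partial_{u_{i+1}}f_{\sigma_{i+1}}(0,t)+\mathfrak a_i(t)\,\partial_{v_{i+1}}f_{\sigma_{i+1}}(0,t)$. **Ample.** A space $\mathcal{D}$ of differentiable functions on $\mathcal{M}$ is ample if for every point $\gamma$ of every face $\sigma$ the space of vectors $[f_\sigma(\gamma),\partial_{u_\sigma}f_\sigma(\gamma),\partial_{v_\sigma}f_\sigma(\gamma)]$, $f\in\mathcal{D}$, has dimension $3$, where $(u_\sigma,v_\sigma)$ are the coordinates on $\sigma$.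
   Formalization: The differentiable functions in the ampleness hypothesis are taken to be twice differentiable on each face; with merely once differentiable (or C^1) functions the claim fails, e.g. four squares with all b_i=-1, a_1(t)=t and the other a_i=0. *)

(* Defs.v *)
From HB Require Import structures.
From mathcomp Require Import all_boot all_order all_algebra.
From mathcomp Require Import all_classical all_reals all_analysis.

Set Implicit Arguments.
Unset Strict Implicit.
Unset Printing Implicit Defensive.

Import Order.TTheory GRing.Theory Num.Theory.
Import numFieldNormedType.Exports.

Local Open Scope classical_set_scope.
Local Open Scope ring_scope.

Definition C1_on (R : realType) (V W : normedModType R) (U : set V)
    (f : V -> W) : Prop :=
  forall x, U x ->
    differentiable f x /\ forall h : V, {for x, continuous ('D_h f)}.

Definition twice_differentiable_on (R : realType) (V W : normedModType R)
    (U : set V) (f : V -> W) : Prop :=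
  forall x, U x ->
    differentiable f x /\ forall h : V, differentiable ('D_h f) x.

Section Polygon.
Variables (R : realType) (n : nat) (p : 'I_n -> R * R).

(* [ordS] is the cyclic successor of 'I_n. *)
Definition side_point (k : 'I_n) (t : R) : R * R :=
  (1 - t) *: p k + t *: p (ordS k).

Definition side (k : 'I_n) : set (R * R) := side_point k @` `[0, 1].

(* The sides, each without its last endpoint, are run through injectively. *)
Definition simple_polygon : Prop :=
  forall (k l : 'I_n) (s t : R), 0 <= s < 1 -> 0 <= t < 1 ->
    side_point k s = side_point l t -> k = l /\ s = t.

Definition polygon_boundary : set (R * R) := \bigcup_(k in setT) side k.

(* The closed region bounded by the sides: the boundary together with the
   bounded connected components of its complement. *)
Definition polygon_region : set (R * R) :=
  polygon_boundary `|`
  [set x | ~ polygon_boundary x /\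
           bounded_set (connected_component (~` polygon_boundary) x)].

End Polygon.

(* A pair (s, k) of a face s and an index k stands both for the k-th vertex of
   the polygon s and for its side from the k-th to the (k+1)-st vertex.
   [twin] pairs the polygon edges; its fixed points are the edges that are not
   identified with another edge.  [glue e] is only meaningful on the edge e. *)
Record surface (R : realType) := Surface {
  face : finType ;
  degree : face -> nat ;
  vtx : forall s : face, 'I_(degree s) -> R * R ;
  degree_ge3 : forall s, (3 <= degree s)%N ;
  vtx_simple : forall s, simple_polygon (@vtx s) ;
  twin : {s : face & 'I_(degree s)} -> {s : face & 'I_(degree s)} ;
  twinK : involutive twin ;
  glue : {s : face & 'I_(degree s)} -> R * R -> R * R ;
  glue_continuous : forall e, twin e != e ->
    {within side (@vtx (tag e)) (tagged e), continuous (glue e)} ;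
  glue_side : forall e x, twin e != e -> side (@vtx (tag e)) (tagged e) x ->
    side (@vtx (tag (twin e))) (tagged (twin e)) (glue e x) ;
  glueK : forall e x, twin e != e -> side (@vtx (tag e)) (tagged e) x ->
    glue (twin e) (glue e x) = x
}.

Section Surface.
Variables (R : realType) (M : surface R).

Definition pedge := {s : face M & 'I_(degree s)}.

Definition face_region (s : face M) : set (R * R) := polygon_region (@vtx R M s).

Definition edge_set (e : pedge) : set (R * R) :=
  side (@vtx R M (tag e)) (tagged e).

Definition interior_edge (e : pedge) : bool := twin e != e.

Definition pvertex (k : pedge) : R * R := vtx (tagged k).

Definition succ_edge (k : pedge) : pedge := Tagged _ (ordS (tagged k)).
Definition pred_edge (k : pedge) : pedge := Tagged _ (ord_pred (tagged k)).

(* A flag is a polygon vertex together with an ordering of the two polygon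
   edges meeting there: the first one carries the coordinate u, the second one
   the coordinate v. *)
Definition flag := (pedge * bool)%type.

Definition corner (x : flag) : pedge := x.1.
Definition uedge (x : flag) : pedge := if x.2 then x.1 else pred_edge x.1.
Definition vedge (x : flag) : pedge := if x.2 then pred_edge x.1 else x.1.
Definition origin (x : flag) : R * R := pvertex x.1.
Definition uend (x : flag) : R * R :=
  pvertex (if x.2 then succ_edge x.1 else pred_edge x.1).
Definition vend (x : flag) : R * R :=
  pvertex (if x.2 then pred_edge x.1 else succ_edge x.1).

(* The point of the plane with affine coordinates (u, v): the vertex is (0, 0),
   the u-edge is [0, 1] x {0} and the v-edge is {0} x [0, 1]. *)
Definition chart (x : flag) (w : R * R) : R * R :=
  origin x + w.1 *: (uend x - origin x) + w.2 *: (vend x - origin x).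

Definition follows (x y : flag) : bool :=
  [&& interior_edge (uedge x), twin (uedge x) == vedge y &
      glue (uedge x) (origin x) == origin y].

(* [c] lists the faces sigma_1, ..., sigma_F around an interior vertex in
   cyclic order: the u-edge of sigma_i is identified with the v-edge of
   sigma_(i+1), both representing tau_i. *)
Definition interior_vertex (c : seq flag) : bool :=
  [&& c != [::], uniq (map corner c) & cycle follows c].

End Surface.

Definition gluing_form (R : realType) (M : surface R)
    (dom : pedge M -> set (R * R)) (phi : pedge M -> R * R -> R * R)
    (x y : flag M) (a b : R -> R) : Prop :=
  let V := [set w | dom (uedge x) (chart x w)] in
  let I := [set u | exists v, V (u, v)] in
  [/\ bijective (chart x), bijective (chart y), C1_on I a, C1_on I b &
    exists rho1 rho2 : R * R -> R, [/\ C1_on V rho1, C1_on V rho2 &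
      forall w, V w ->
        phi (uedge x) (chart x w) =
        chart y (w.2 * b w.1 + w.2 ^+ 2 * rho1 w,
                 w.1 + w.2 * a w.1 + w.2 ^+ 2 * rho2 w)]].

(* The last field only asks for one of the two cyclic orders around each
   interior vertex to admit gluing data: at this regularity, the inverse of a
   transition map of the required form need not be of that form. *)
Record gluing (R : realType) (M : surface R) := Gluing {
  dom : pedge M -> set (R * R) ;
  trans : pedge M -> R * R -> R * R ;
  dom_open : forall e, interior_edge e -> open (dom e) ;
  dom_edge : forall e, interior_edge e -> edge_set e `<=` dom e ;
  trans_dom : forall e x, interior_edge e -> dom e x ->
    dom (twin e) (trans e x) ;
  trans_C1 : forall e, interior_edge e -> C1_on (dom e) (trans e) ;
  transK : forall e x, interior_edge e -> dom e x ->
    trans (twin e) (trans e x) = x ;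
  trans_glue : forall e x, interior_edge e -> edge_set e x ->
    trans e x = glue e x ;
  gluing_form_ex : forall c : seq (flag M), interior_vertex c ->
    exists c' : seq (flag M), exists a b : flag M -> R -> R,
      [/\ interior_vertex c',
          perm_eq (map (@corner R M) c') (map (@corner R M) c) &
          forall x, x \in c' -> gluing_form dom trans x (next c' x) (a x) (b x)]
}.

Section Gluing.
Variables (R : realType) (M : surface R) (G : gluing M).

(* [a x] and [b x] are the gluing data along the u-edge of the flag x. *)
Definition gluing_data (c : seq (flag M)) (a b : flag M -> R -> R) : Prop :=
  forall x, x \in c ->
    gluing_form (dom G) (trans G) x (next c x) (a x) (b x).

Definition crossing_edge (a : R -> R) : Prop := a 0 = 0.

Definition crossing_vertex (c : seq (flag M)) (a : flag M -> R -> R) : Prop :=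
  interior_vertex c /\ forall x, x \in c -> crossing_edge (a x).

Definition same_taylor1 (f g : R * R -> R) (x : R * R) : Prop :=
  f x = g x /\ forall h, 'd f x h = 'd g x h.

(* Members are twice differentiable (not necessarily C^2).  Asking for a single
   derivative would not do: the family of C^1 functions can be ample at a
   crossing vertex without any relation between the first derivatives of the
   gluing data, since these relations come from mixed second derivatives. *)
Definition differentiable_functions : set (face M -> R * R -> R) :=
  [set f | (forall s, exists U : set (R * R),
             [/\ open U, face_region s `<=` U &
                 twice_differentiable_on U (f s)]) /\
           (forall e x, interior_edge e -> edge_set e x ->
             same_taylor1 (f (tag e)) (f (tag (twin e)) \o trans G e) x)].

End Gluing.

Section Ample.
Variables (R : realType) (M : surface R).

Definition jet (f : R * R -> R) (x : R * R) : 'rV[R]_3 :=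
  \row_j [:: f x; 'D_(1, 0) f x; 'D_(0, 1) f x]`_j.

Definition ample (D : set (face M -> R * R -> R)) : Prop :=
  forall (s : face M) (x : R * R), face_region s x ->
    exists V : {vspace 'rV[R]_3},
      (forall w, w \in V <-> exists2 f, D f & w = jet (f s) x) /\
      \dim V = 3%N.

End Ample.

Definition vertex_matrix (R : realType) (a b : R -> R) : 'M[R]_2 :=
  \matrix_(i, j) if i == 0 then (if j == 0 then 0 else 1)
                 else (if j == 0 then b 0 else a 0).

(* Main.v *)
Require Import Defs.
From mathcomp Require Import all_boot all_order all_algebra.
From mathcomp Require Import all_classical all_reals all_analysis.
From mathcomp Require Import ring lra.
Set Implicit Arguments.
Unset Strict Implicit.
Unset Printing Implicit Defensive.
Import Order.TTheory GRing.Theory Num.Theory.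
Import numFieldNormedType.Exports.
Local Open Scope classical_set_scope.
Local Open Scope ring_scope.

(** Write p_i, q_i and w_i for the derivatives in u, in v and in u, v at the
    crossing vertex of a differentiable function on sigma_i.  The compatibility
    conditions along tau_i at t = 0, and the derivative there of the second
    one, read
      p_i = q_(i+1),   q_i = b_i(0) p_(i+1),
      w_i = b_i'(0) p_(i+1) + b_i(0) w_(i+1) + a_i'(0) q_(i+1),
    where the last line uses the symmetry of second derivatives.  Going once
    around the vertex, ampleness applied to (p_1, q_1) gives
    b_2(0) b_4(0) = b_1(0) b_3(0) = 1; hence w_1 cancels from the composite of
    the four equations for the w_i, and the coefficients of p_1 and q_1 in what
    remains are the two relations. *)

(** * Derivatives along lines, compared from the right *)

Section Line.
Variables (R : realType) (V W : normedModType R).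

Lemma is_derive_line (f : V -> W) (x u : V) (t : R) :
  derivable f (x + t *: u) u ->
  is_derive t 1 (fun t => f (x + t *: u)) ('D_u f (x + t *: u)).
Proof.
have E : (fun h : R => h^-1 *: (((fun t => f (x + t *: u)) \o shift t) (h *: 1)
            - f (x + t *: u))) =
         (fun h : R => h^-1 *: ((f \o shift (x + t *: u)) (h *: u)
            - f (x + t *: u))).
  apply/funext => h /=; congr (_ *: (f _ - _)).
  by rewrite [h *: 1]mulr1 scalerDl addrCA.
by move=> df; split; rewrite /derivable /derive E.
Qed.

Lemma is_derive_line0 (f : V -> W) (x u : V) :
  derivable f x u ->
  is_derive (0 : R) 1 (fun t => f (x + t *: u)) ('D_u f x).
Proof.
move=> df; have := @is_derive_line f x u 0; rewrite scale0r addr0; exact.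
Qed.

(** Compatibility along an edge is known only for t in [0, 1], so the derivatives at the endpoint 0
    are compared through right-hand limits of difference quotients. *)
Lemma eq_derive_right (f g : R -> W) (df dg : W) :
  is_derive (0 : R) 1 f df -> is_derive (0 : R) 1 g dg ->
  (forall t, 0 <= t <= 1 -> f t = g t) -> df = dg.
Proof.
move=> [cf <-] [cg <-] fg; rewrite /derive.
have P : ProperFilter (0 : R)^'+ by apply: at_right_proper_filter.
have := cvg_dnbhs_at_right cf; have := cvg_dnbhs_at_right cg.
move=> hg hf; apply: (norm_cvg_unique hf); apply: cvg_trans hg.
apply: near_eq_cvg; near=> h.
have h01 : 0 <= h <= 1.
  by apply/andP; split; [near: h; exact: nbhs_right_ge|near: h; exact: nbhs_right_le].
by rewrite /= [h *: 1]mulr1 !addr0 !fg ?lexx ?ler01.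
Unshelve. all: by end_near. Qed.

End Line.

(** * Symmetry of second derivatives *)

Section MixedDerivatives.
Variables (R : realType) (V : normedModType R) (f : V -> R) (x : V).

Hypothesis df : \forall y \near x, differentiable f y.

(* The mean value theorem in the direction [u] turns the second difference into
   an increment of ['D_u f] in the direction [v]. *)
Lemma second_difference_cvg (u v : V) : differentiable ('D_u f) x ->
  (fun s : R => s ^- 2 *
     (f (x + s *: (u + v)) - f (x + s *: v) - f (x + s *: u) + f x))
    @ 0^'+ --> 'D_v ('D_u f) x.
Proof.
move=> dF; rewrite (deriveE _ dF); apply/cvgrPdist_le => e e0.
(* The expansion of [F] is used at t u and at t u + s v with t <= s; the norms of these add up to at
   most s (2 |u| + |v|). The summand 1 keeps [C] positive. *)
set F := 'D_u f in dF *; pose C := (`|u| *+ 2 + `|v| + 1).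
have C0 : 0 < C by rewrite ltr_wpDl // addr_ge0 // mulrn_wge0.
have [r /= r0 rf] := (nbhs_ballP _ _).1 df.
have /eqaddoP /(_ (e / C) (divr_gt0 e0 C0)) := diff_locally dF.
move/nbhs_ballP => [d /= d0 dd].
have {}dd h : `|h| < d -> `|F (x + h) - F x - 'd F x h| <= e / C * `|h|.
  move=> hd; have /dd /= : ball (0 : V) d h by rewrite -ball_normE /= sub0r normrN.
  by rewrite !fctE [h + x]addrC opprD addrA.
have {}rf h : `|h| < r -> differentiable f (x + h).
  by move=> hr; apply: rf; rewrite -ball_normE /= opprD addNKr normrN.
near=> s.
have s0 : 0 < s by near: s; exact: nbhs_right_gt.
have sC : s * C < Num.min r d.
  rewrite -ltr_pdivlMr //; near: s; apply: nbhs_right_lt.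
  by rewrite divr_gt0 // lt_min r0.
move: sC; rewrite lt_min => /andP[sr sd].
have bnd t : 0 <= t -> t <= s ->
    `|t *: u| <= s * `|u| /\ `|t *: u + s *: v| <= s * (`|u| + `|v|).
  move=> t0 ts; have H : `|t *: u| <= s * `|u|.
    by rewrite normrZ ger0_norm // ler_wpM2r.
  split => //; apply: le_trans (ler_normD _ _) _.
  by rewrite mulrDr lerD // normrZ gtr0_norm.
have leC : `|u| <= C /\ `|u| + `|v| <= C.
  rewrite /C mulr2n; split; have := normr_ge0 u; have := normr_ge0 v; lra.
have small t : 0 <= t -> t <= s ->
    `|t *: u| <= s * C /\ `|t *: u + s *: v| <= s * C.
  move=> t0 ts; have [h1 h2] := bnd _ t0 ts.
  by split; [apply: le_trans h1 _|apply: le_trans h2 _]; rewrite ler_pM2l //; case: leC.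
pose phi t := f ((x + s *: v) + t *: u) - f (x + t *: u).
pose phi' t := F ((x + s *: v) + t *: u) - F (x + t *: u).
have dphi t : 0 <= t -> t <= s -> is_derive t 1 phi (phi' t).
  move=> t0 ts; have [h1 h2] := small _ t0 ts.
  apply: is_deriveB; apply: is_derive_line; apply: diff_derivable.
    rewrite -addrA [s *: v + _]addrC; apply: rf; exact: le_lt_trans h2 sr.
  by apply: rf; exact: le_lt_trans h1 sr.
have [] := @MVT _ phi phi' 0 s s0.
- move=> t; rewrite in_itv /= => /andP[t0 ts]; apply: dphi; exact: ltW.
- apply: derivable_within_continuous => t; rewrite in_itv /= => /andP[t0 ts].
  by have [] := dphi t t0 ts.
move=> t; rewrite in_itv /= => /andP[/ltW t0 /ltW ts] E.
have -> : f (x + s *: (u + v)) - f (x + s *: v) - f (x + s *: u) + f x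
    = phi s - phi 0.
  rewrite /phi !scale0r !addr0 scalerDr [s *: u + _]addrC addrA; ring.
rewrite E subr0.
have [h1 h2] := small _ t0 ts; have [k1 k2] := bnd _ t0 ts.
have dZ c w : 'd F x (c *: w) = c * 'd F x w by rewrite linearZ.
have := dd _ (le_lt_trans h1 sd); have := dd _ (le_lt_trans h2 sd).
rewrite linearD !dZ => l1 l2.
have {}E : s ^- 2 * (phi' t * s) = s^-1 * phi' t by field; exact: lt0r_neq0.
suff : `|'d F x v - s^-1 * phi' t| <= e by rewrite -E.
rewrite -(ler_pM2l s0) -{1}(gtr0_norm s0) -normrM mulrBr mulVKf ?gt_eqF //.
(* Both parentheses are remainders of the first-order expansion of [F] at x; the contributions of t
   u cancel. *)
have -> : s * 'd F x v - phi' t =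
   (F (x + t *: u) - F x - t * 'd F x u) -
   (F (x + (t *: u + s *: v)) - F x - (t * 'd F x u + s * 'd F x v)).
  rewrite /phi' -[x + s *: v + _]addrA [s *: v + _]addrC; ring.
apply: le_trans (ler_normB _ _) _.
apply: le_trans (lerD l2 l1) _; rewrite -mulrDr.
have -> : s * e = e / C * (s * C) by field; exact: lt0r_neq0.
rewrite ler_pM2l ?divr_gt0 //.
apply: ltW; apply: le_lt_trans (lerD k1 k2) _; rewrite -mulrDr ltr_pM2l // /C mulr2n; lra.
Unshelve. all: by end_near. Qed.

(** The second difference is symmetric in u and v, so both mixed derivatives are limits of the same
    quotient. *)
Lemma derive_comm (u v : V) :
  differentiable ('D_u f) x -> differentiable ('D_v f) x ->
  'D_u ('D_v f) x = 'D_v ('D_u f) x.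
Proof.
move=> /(@second_difference_cvg u v) du /(@second_difference_cvg v u) dv.
have P : ProperFilter (0 : R)^'+ by apply: at_right_proper_filter.
apply: (norm_cvg_unique dv); apply: cvg_trans du; apply: near_eq_cvg.
near=> s; rewrite /= [v + u]addrC; congr (_ * _); ring.
Unshelve. all: by end_near. Qed.

End MixedDerivatives.

Lemma line_cvg0 (R : realType) (V : normedModType R) (p v : V) :
  (p + s *: v) @[s --> (0 : R)] --> p.
Proof.
rewrite -[X in _ --> X]addr0 -(scale0r v).
by apply: cvgD; [exact: cvg_cst|apply: cvgZr_tmp; exact: cvg_id].
Qed.

(** * Affine coordinates at a corner *)

Section Flags.
Variables (R : realType) (M : surface R).
Implicit Types (x y : flag M) (t : R).

(** Since charts are affine, partial derivatives in u and v are directional derivatives along these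
    two edge vectors. *)
Definition udir x : R * R := uend x - origin x.
Definition vdir x : R * R := vend x - origin x.

Lemma chartE x (w : R * R) : chart x w = origin x + w.1 *: udir x + w.2 *: vdir x.
Proof. by []. Qed.

Lemma tag_uedge x : tag (uedge x) = tag x.1.
Proof. by case: x => [k []]. Qed.

Lemma tag_vedge x : tag (vedge x) = tag x.1.
Proof. by case: x => [k []]. Qed.

Lemma edge_set_uedge x t : 0 <= t <= 1 -> edge_set (uedge x) (origin x + t *: udir x).
Proof.
case: x => [k []] t01; rewrite /edge_set /udir /uend /origin /uedge /=.
  exists t; first by rewrite /= in_itv.
  by rewrite /side_point /pvertex /= scalerBl scale1r scalerBr -addrA [- _ + _]addrC.
(* For this orientation of the flag the u-edge is the preceding side, run through backwards. *)
exists (1 - t).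
  by move: t01 => /andP[t0 t1]; rewrite /= in_itv /= subr_ge0 t1 gerBl.
rewrite /side_point /pvertex /= ord_predK opprB addrCA subrr addr0.
by rewrite scalerBl scale1r scalerBr addrCA.
Qed.

Lemma edge_set_region (e : pedge M) : edge_set e `<=` face_region (tag e).
Proof. by move=> z ez; left; exists (tagged e). Qed.

Lemma origin_region x : face_region (tag x.1) (origin x).
Proof.
rewrite -tag_uedge; apply: edge_set_region.
by have := @edge_set_uedge x 0; rewrite scale0r addr0; apply; rewrite lexx ler01.
Qed.

(** Surjectivity of the chart writes both standard basis vectors as combinations of the edge
    vectors; multiplicativity of the determinant then makes this one invertible. *)
Lemma udir_vdir_det x : bijective (chart x) ->
  (udir x).1 * (vdir x).2 - (udir x).2 * (vdir x).1 != 0.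
Proof.
move=> [g _ gK].
have : chart x (g (origin x + (1, 0))) = origin x + (1, 0) by rewrite gK.
have : chart x (g (origin x + (0, 1))) = origin x + (0, 1) by rewrite gK.
rewrite !chartE -!addrA => /addrI + /addrI.
case: (g _) => c d; case: (g _) => a b; case: (udir x) => u1 u2; case: (vdir x) => v1 v2.
move=> [] /= E1 E2 [] /= E3 E4; apply/eqP => D0.
have : (a * d - b * c) * (u1 * v2 - u2 * v1) =
  (a * u1 + b * v1) * (c * u2 + d * v2) - (a * u2 + b * v2) * (c * u1 + d * v1).
  by ring.
by rewrite D0 E1 E2 E3 E4; lra.
Qed.

End Flags.

(** * First derivatives across an edge *)

Section Transition.
Variables (R : realType) (M : surface R) (G : gluing M).
Variables (x y : flag M) (a b : R -> R).
Hypothesis fxy : follows x y.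
Hypothesis gxy : gluing_form (dom G) (trans G) x y a b.

Let xint : interior_edge (uedge x). Proof. by case/and3P: fxy. Qed.

Lemma dom_uedge t : 0 <= t <= 1 -> dom G (uedge x) (origin x + t *: udir x).
Proof. by move=> /(edge_set_uedge x); apply: dom_edge. Qed.

Lemma trans_uedge t : 0 <= t <= 1 ->
  trans G (uedge x) (origin x + t *: udir x) = origin y + t *: vdir y.
Proof.
move=> /dom_uedge d; have [_ _ _ _ [r1 [r2 [_ _ /(_ (t, 0))]]]] := gxy.
rewrite !chartE /= !(scale0r, addr0, expr2, mul0r) => -> //.
by rewrite /= chartE /= scale0r addr0.
Qed.

(** The terms quadratic in v contribute only [s * r1] and [s * r2] to the difference quotient, and
    these tend to 0 because [r1] and [r2] are continuous at (t, 0). *)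
Lemma derive_trans_uedge t : 0 <= t <= 1 ->
  'D_(vdir x) (trans G (uedge x)) (origin x + t *: udir x)
  = b t *: udir y + a t *: vdir y.
Proof.
move=> t01; have d := dom_uedge t01.
have [_ _ _ _ [r1 [r2 [c1 c2 E]]]] := gxy.
have V0 : [set w | dom G (uedge x) (chart x w)] (t, 0).
  by rewrite /= chartE /= scale0r addr0.
have line : ((t, s) : R * R) @[s --> (0:R)] --> ((t, 0) : R * R).
  rewrite [X in X @ _](_ : _ = fun s : R => (t, 0) + s *: (0, 1)).
    exact: line_cvg0.
  by apply/funext => s; congr pair; rewrite /= ?scaler0 ?addr0 // add0r [_ *: _]mulr1.
have rc (r : R * R -> R) : C1_on [set w | dom G (uedge x) (chart x w)] r ->
    r (t, s) @[s --> (0 : R)^'] --> r (t, 0).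
  move=> /(_ _ V0)[/differentiable_continuous rcont _].
  apply: (cvg_trans (cvg_app _ (@nbhs_dnbhs _ _))); exact: cvg_comp line rcont.
apply: cvg_lim => //.
(* For small nonzero s this is the difference quotient itself, by the gluing form. *)
pose g (s : R) := (b t + s * r1 (t, s)) *: udir y + (a t + s * r2 (t, s)) *: vdir y.
have c0 (c : R) (r : R * R -> R) : C1_on [set w | dom G (uedge x) (chart x w)] r ->
    (c + s * r (t, s)) @[s --> (0 : R)^'] --> c.
  move=> /rc cr.
  have : (c + s * r (t, s)) @[s --> (0 : R)^'] --> c + 0 * r (t, 0).
    apply: cvgD; first exact: cvg_cst.
    by apply: cvgM => //; exact: nbhs_dnbhs.
  by rewrite mul0r addr0.
have : g s @[s --> (0 : R)^'] --> b t *: udir y + a t *: vdir y.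
  by apply: cvgD; apply: cvgZr_tmp; exact: c0.
apply: cvg_trans; apply: near_eq_cvg; near=> s.
have s0 : s != 0 by near: s; exact: nbhs_dnbhs_neq.
have ds : dom G (uedge x) (chart x (t, s)).
  rewrite chartE /=; near: s; apply: nbhs_dnbhs.
  have := @line_cvg0 _ _ (origin x + t *: udir x) (vdir x).
  by apply; apply: open_nbhs_nbhs; split => //; exact: dom_open.
have := E _ ds; rewrite trans_uedge // chartE /= [in X in X -> _]addrC => ->.
rewrite chartE /= -[t + _ + _]addrA [(t + _) *: _]scalerDl.
rewrite -[origin y + _ + _]addrA opprD addrACA subrr add0r addrCA [t *: _ + _]addrC addrK.
by rewrite !expr2 -!mulrA -!mulrDr -!scalerA -scalerDr scalerK.
Unshelve. all: by end_near. Qed.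

Variable f : face M -> R * R -> R.
Hypothesis Df : differentiable_functions G f.

Let fx := f (tag x.1).
Let fy := f (tag y.1).

Lemma twin_uedge : twin (uedge x) = vedge y.
Proof. by case/and3P: fxy => _ /eqP. Qed.

(** The chain rule through the transition map turns the coordinate-free agreement of differentials
    into the relation in u and v. *)
Lemma taylor_across t : 0 <= t <= 1 ->
  fx (origin x + t *: udir x) = fy (origin y + t *: vdir y) /\
  'D_(vdir x) fx (origin x + t *: udir x) =
    b t * 'D_(udir y) fy (origin y + t *: vdir y) +
    a t * 'D_(vdir y) fy (origin y + t *: vdir y).
Proof.
move=> t01; case: Df => reg same.
have ex := edge_set_uedge x t01.
have dreg s z : face_region s z -> differentiable (f s) z.
  by have [U [_ sU dU]] := reg s => /sU /dU[].
have := same _ _ xint ex; rewrite twin_uedge tag_uedge tag_vedge.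
rewrite -/fx -/fy => -[E1 E2]; rewrite -trans_uedge //; split => //.
have ry : face_region (tag y.1) (trans G (uedge x) (origin x + t *: udir x)).
  rewrite -tag_vedge; apply: edge_set_region; rewrite -twin_uedge trans_glue //.
  exact: glue_side.
have rx : face_region (tag x.1) (origin x + t *: udir x).
  by rewrite -tag_uedge; exact: edge_set_region.
have dfx := dreg _ _ rx; have dfy := dreg _ _ ry.
have [dT _] := trans_C1 xint (dom_uedge t01).
rewrite (deriveE _ dfx) E2 (diff_comp dT dfy) /=.
rewrite -(deriveE _ dT) (derive_trans_uedge t01).
by rewrite (deriveE (udir y) dfy) (deriveE (vdir y) dfy) linearD !linearZ.
Qed.

End Transition.

(** * Derivatives at a crossing vertex *)

Section Crossing.
Variables (R : realType) (M : surface R) (G : gluing M).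
Variables (f : face M -> R * R -> R).
Hypothesis Df : differentiable_functions G f.

Lemma differentiable_functions_near s z : face_region s z ->
  [/\ \forall w \near z, differentiable (f s) w &
      forall h, differentiable ('D_h (f s)) z].
Proof.
move=> sz; have [U [oU sU dU]] := Df.1 s; have [_ dz] := dU _ (sU _ sz).
split=> //; have : nbhs z U by apply: open_nbhs_nbhs; split => //; exact: sU.
by apply: filterS => w /dU[].
Qed.

(** [du], [dv] and [duv] are the p, q and w of the overview. *)
Definition du (x : flag M) := 'D_(udir x) (f (tag x.1)) (origin x).
Definition dv (x : flag M) := 'D_(vdir x) (f (tag x.1)) (origin x).
Definition duv (x : flag M) :=
  'D_(udir x) ('D_(vdir x) (f (tag x.1))) (origin x).

Lemma duvC x : duv x = 'D_(vdir x) ('D_(udir x) (f (tag x.1))) (origin x).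
Proof.
have [dn d2] := differentiable_functions_near (origin_region x).
exact: derive_comm.
Qed.

Variables (x y : flag M) (a b : R -> R).
Hypothesis fxy : follows x y.
Hypothesis gxy : gluing_form (dom G) (trans G) x y a b.
Hypothesis a0 : a 0 = 0.

(** The first and third relations are derivatives at t = 0 of the two compatibility conditions. In
    the third, a(0) = 0 removes the pure second derivative in v, so the relations involve only p, q
    and w. *)
Lemma crossing_jet :
  [/\ du x = dv y, dv x = b 0 * du y &
      duv x = derive1 b 0 * du y + b 0 * duv y + derive1 a 0 * dv y].
Proof.
have T := taylor_across fxy gxy Df.
have [dnx d2x] := differentiable_functions_near (origin_region x).
have [dny d2y] := differentiable_functions_near (origin_region y).
have dx := nbhs_singleton dnx; have dy := nbhs_singleton dny.
have lin (g : R * R -> R) (z v : R * R) : differentiable g z -> is_derive (0 : R) 1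
    (fun t => g (z + t *: v)) ('D_v g z : R).
  by move=> dg; apply: is_derive_line0; exact: diff_derivable.
have I0 : exists v, dom G (uedge x) (chart x (0, v)).
  exists 0; rewrite chartE !scale0r !addr0.
  have := @dom_uedge _ _ G _ _ fxy 0; rewrite scale0r addr0; apply.
  by rewrite lexx ler01.
have [_ _ ca cb _] := gxy.
have da : is_derive (0 : R) 1 a (derive1 a 0).
  by rewrite derive1E; apply: DeriveDef => //; apply: diff_derivable; case: (ca _ I0).
have db : is_derive (0 : R) 1 b (derive1 b 0).
  by rewrite derive1E; apply: DeriveDef => //; apply: diff_derivable; case: (cb _ I0).
split.
- by apply: (eq_derive_right (@lin _ _ (udir x) dx) (@lin _ _ (vdir y) dy)) => t /T[].
- have [|_] := T 0; first by rewrite lexx ler01.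
  by rewrite !scale0r !addr0 a0 mul0r addr0.
(* On the side of [y] the edge runs along [vdir y], so the mixed derivative arises there in the
   opposite order. *)
- rewrite [duv y]duvC [duv x]/duv.
  have D1 := is_deriveD (is_deriveM db (@lin _ _ (vdir y) (d2y (udir y))))
                        (is_deriveM da (@lin _ _ (vdir y) (d2y (vdir y)))).
  rewrite (eq_derive_right (@lin _ _ (udir x) (d2x (vdir x))) D1); last by move=> t /T[].
  rewrite !scale0r !addr0 a0 scale0r add0r -/(du y) -/(dv y).
  by congr (_ + _); [rewrite addrC; congr (_ + _)|]; exact: mulrC.
Qed.

End Crossing.

(** Ampleness prescribes the gradient in standard coordinates; independence of the edge vectors
    carries this over to the directions u and v. *)
Lemma ample_jet (R : realType) (M : surface R) (G : gluing M) (x : flag M) (p q : R) :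
  ample (differentiable_functions G) -> bijective (chart x) ->
  exists2 f, differentiable_functions G f & du f x = p /\ dv f x = q.
Proof.
move=> am /udir_vdir_det; have [V [Vj dimV]] := am _ _ (origin_region x).
have VT : V = fullv.
  by apply/eqP; rewrite -(dimv_leqif_eq (subvf V)) dimV dimvf /dim /= mul1n.
set u := udir x; set v := vdir x; set d := u.1 * v.2 - u.2 * v.1 => d0.
(* Cramer's rule for the gradient (al, be) with derivatives p along u and q along v. The function
   value 0 prescribed with it is an arbitrary choice. *)
pose al := (p * v.2 - q * u.2) / d; pose be := (q * u.1 - p * v.1) / d.
have := (Vj (\row_j [:: 0; al; be]`_j)).1; rewrite VT memvf => -[] // f Df E.
exists f => //.
have [/nbhs_singleton df _] := differentiable_functions_near Df (origin_region x).
have Ea : 'D_(1, 0) (f (tag x.1)) (origin x) = al.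
  by have /rowP /(_ (1 : 'I_3)) := E; rewrite !mxE.
have Eb : 'D_(0, 1) (f (tag x.1)) (origin x) = be.
  by have /rowP /(_ (2 : 'I_3)) := E; rewrite !mxE.
have D (h : R * R) : 'D_h (f (tag x.1)) (origin x) = h.1 * al + h.2 * be.
  rewrite -Ea -Eb !deriveE //.
  have {1}-> : h = h.1 *: (1, 0) + h.2 *: (0, 1).
    by case: h => h1 h2; congr pair; rewrite /= scaler0 ?addr0 ?add0r [_ *: _]mulr1.
  by rewrite linearD !linearZ.
by rewrite /du /dv -/u -/v !D /al /be; split; rewrite /d; field.
Qed.

(** * The relations at a crossing vertex with four edges *)

Theorem lemma2p8 (R : realType) (M : surface R) (G : gluing M)
  (hample : ample (differentiable_functions G))
  (hvertex : forall (c : seq (flag M)) (a b : flag M -> R -> R),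
    interior_vertex c -> gluing_data G c a b ->
    \prod_(x <- c) vertex_matrix (a x) (b x) = 1)
  (x1 x2 x3 x4 : flag M) (a b : flag M -> R -> R)
  (hdata : gluing_data G [:: x1; x2; x3; x4] a b)
  (hcross : crossing_vertex [:: x1; x2; x3; x4] a) :
  derive1 (a x1) 0 + derive1 (b x4) 0 / b x4 0
    = - b x1 0 * (derive1 (a x3) 0 + derive1 (b x2) 0 / b x2 0)
  /\
  derive1 (a x2) 0 + derive1 (b x1) 0 / b x1 0
    = - b x2 0 * (derive1 (a x4) 0 + derive1 (b x3) 0 / b x3 0).
Proof.
have [/and3P[_ /map_uniq Un Cy] a0] := hcross.
have {}a0 x : x \in [:: x1; x2; x3; x4] -> a x 0 = 0 by exact: a0.
have step x : x \in [:: x1; x2; x3; x4] ->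
    gluing_form (dom G) (trans G) x (next [:: x1; x2; x3; x4] x) (a x) (b x) /\
    follows x (next [:: x1; x2; x3; x4] x).
  by move=> xc; split; [exact: hdata|exact: next_cycle].
have in1 : x1 \in [:: x1; x2; x3; x4] by rewrite !inE eqxx.
have in2 : x2 \in [:: x1; x2; x3; x4] by rewrite !inE eqxx !orbT.
have in3 : x3 \in [:: x1; x2; x3; x4] by rewrite !inE eqxx !orbT.
have in4 : x4 \in [:: x1; x2; x3; x4] by rewrite !inE eqxx !orbT.
(* [next] searches the list by equality tests, so the four flags must be distinct; this comes from
   their distinct corners. *)
have [n1 n2 n3 n4] : [/\ next [:: x1; x2; x3; x4] x1 = x2,
    next [:: x1; x2; x3; x4] x2 = x3, next [:: x1; x2; x3; x4] x3 = x4 &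
    next [:: x1; x2; x3; x4] x4 = x1].
  move: Un; rewrite /= !inE !negb_or.
  move=> /and4P[/and3P[h12 h13 h14] /andP[h23 h24] h34 _].
  rewrite !eqxx (eq_sym x2 x1) (eq_sym x3 x1) (eq_sym x4 x1) (eq_sym x3 x2).
  rewrite (eq_sym x4 x2) (eq_sym x4 x3) (negPf h12) (negPf h13) (negPf h14).
  by rewrite (negPf h23) (negPf h24) (negPf h34).
have [g1 f1] := step _ in1; have [g2 f2] := step _ in2.
have [g3 f3] := step _ in3; have [g4 f4] := step _ in4.
rewrite n1 in g1 f1; rewrite n2 in g2 f2; rewrite n3 in g3 f3; rewrite n4 in g4 f4.
have bx1 : bijective (chart x1) by case: g1.
have jets (p q : R) : exists2 f, differentiable_functions G f &
    du f x1 = p /\ dv f x1 = q by exact: ample_jet.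
(* Everything is expressed by the derivatives p, q, w at [x1], with p and q free by ampleness. *)
have cycle4 (p q : R) :
  [/\ p = b x2 0 * b x4 0 * p, q = b x1 0 * b x3 0 * q &
   exists w : R, w = derive1 (b x1) 0 * (b x3 0 * q) + derive1 (a x1) 0 * p
    + b x1 0 * (derive1 (b x2) 0 * (b x4 0 * p) + derive1 (a x2) 0 * (b x3 0 * q)
    + b x2 0 * (derive1 (b x3) 0 * q + derive1 (a x3) 0 * (b x4 0 * p)
    + b x3 0 * (derive1 (b x4) 0 * p + derive1 (a x4) 0 * q
    + b x4 0 * w)))].
  have [f Df [<- <-]] := jets p q.
  have [p1 q1 w1] := crossing_jet Df f1 g1 (a0 _ in1).
  have [p2 q2 w2] := crossing_jet Df f2 g2 (a0 _ in2).
  have [p3 q3 w3] := crossing_jet Df f3 g3 (a0 _ in3).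
  have [p4 q4 w4] := crossing_jet Df f4 g4 (a0 _ in4).
  have P3 : du f x3 = b x4 0 * du f x1 by rewrite p3.
  have P2 : du f x2 = b x3 0 * dv f x1 by rewrite p2 q3 p4.
  split.
  - by rewrite {1}p1 q2 P3 mulrA.
  - by rewrite {1}q1 P2 mulrA.
  exists (duv f x1); rewrite {1}w1 w2 w3 w4 -p1 -p2 -p3 p4 P2 P3; ring.
(* These two choices extract the coefficients of p and q. *)
have [+ _ [w +]] := cycle4 1 0; have [_ + [w' +]] := cycle4 0 1.
rewrite !mulr1 !mulr0 !addr0 !add0r => e13 E' e24 E.
have b1 : b x1 0 != 0 by apply/eqP => b1; move: e13 => /eqP; rewrite b1 mul0r oner_eq0.
have b2 : b x2 0 != 0 by apply/eqP => b2; move: e24 => /eqP; rewrite b2 mul0r oner_eq0.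
have B3 : b x3 0 = (b x1 0)^-1 by apply: (mulfI b1); rewrite -e13 divff.
have B4 : b x4 0 = (b x2 0)^-1 by apply: (mulfI b2); rewrite -e24 divff.
(* With c and d for b_1(0) and b_2(0), the coefficient of z on the right is c d c^-1 d^-1 = 1, so z
   cancels. *)
have alg1 (A B C D c d z : R) : c != 0 -> d != 0 ->
    z = A + c * (B / d + d * (C / d + c^-1 * (D + d^-1 * z))) ->
    A + D / d^-1 = - c * (C + B / d).
  by move=> c0 d0 zE; rewrite -[LHS]subr0 -(subrr z) {1}zE; field; rewrite c0 d0.
have alg2 (A B C D c d z : R) : c != 0 -> d != 0 ->
    z = A / c + c * (B / c + d * (C + c^-1 * (D + d^-1 * z))) ->
    B + A / c = - d * (D + C / c^-1).
  by move=> c0 d0 zE; rewrite -[LHS]subr0 -(subrr z) {1}zE; field; rewrite c0 d0.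
move: E E'; rewrite B3 B4 => E E'.
by split; [exact: alg1 E|exact: alg2 E'].
Qed.
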